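(* Let $\mathbf a,\mathbf b\in\{0,1\}^\infty$. Let $\Sigma_{\mathbf a,\mathbf b}=\{i_1i_2\cdots\in\{0,1\}^\infty:\mathbf a\le i_ni_{n+1}\cdots\le\mathbf b\text{ for all }n\ge1\}$ and $\Omega_{0\mathbf b,1\mathbf a}=\{i_1i_2\cdots\in\{0,1\}^\infty : i_ni_{n+1}\cdots\le0\mathbf b\text{ or } i_ni_{n+1}\cdots\ge1\mathbf a\text{ for all }n\ge1\}$. Then $\Omega_{0\mathbf b,1\mathbf a}=0^*\Sigma_{\mathbf a,\mathbf b}\cup1^*\Sigma_{\mathbf a,\mathbf b}\cup\{\overline{0},\overline{1}\}$. Hence $\Sigma_{\mathbf a,\mathbf b}=\emptyset$ if and only if $\Omega_{0\mathbf b,1\mathbf a}=\{\overline{0},\overline{1}\}$; $\Sigma_{\mathbf a,\mathbf b}$ is countable if and only if $\Omega_{0\mathbf b,1\mathbf a}$ is countable; and $h(\Sigma_{\mathbf a,\mathbf b})=h(\Omega_{0\mathbf b,1\mathbf a})$.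
   Context: Sequences in $\{0,1\}^\infty$ are ordered lexicographically with $0<1$. $\overline{c}$ is the infinite repetition of $c$; $c^*=\{c^k:k\ge0\}$ for a letter $c$, and $c^*X=\{c^k\mathbf x:k\ge0,\mathbf x\in X\}$. Entropy of a shift-invariant $X\subseteq\{0,1\}^\infty$: $h(X)=\lim_n\frac1n\log A_n(X)$, with $A_n(X)$ the number of distinct length-$n$ blocks occurring in elements of $X$. *)

(* Defs.v *)
From mathcomp Require Import all_boot all_order all_algebra.
From mathcomp Require Import all_classical all_reals all_analysis.
From mathcomp Require Import lra.

Set Implicit Arguments.
Unset Strict Implicit.
Unset Printing Implicit Defensive.

Import Order.TTheory GRing.Theory Num.Theory.
Import numFieldNormedType.Exports.

Local Open Scope classical_set_scope.
Local Open Scope ring_scope.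

(* The digit 0 is [false] and 1 is [true]; a sequence i_1 i_2 ... is indexed
   from 0, so that i_n i_{n+1} ... (n >= 1) is [tail n.-1 i]. *)
Definition binseq : Type := nat -> bool.

Definition tail (n : nat) (x : binseq) : binseq := fun k => x (n + k)%N.

Definition scons (c : bool) (x : binseq) : binseq :=
  fun k => if k is k'.+1 then x k' else c.

Definition lex_lt (x y : binseq) : Prop :=
  exists n : nat, (forall k, (k < n)%N -> x k = y k) /\
                  x n = false /\ y n = true.

Definition lex_le (x y : binseq) : Prop := x = y \/ lex_lt x y.

Definition Sigma (a b : binseq) : set binseq :=
  [set x | forall n, lex_le a (tail n x) /\ lex_le (tail n x) b].

Definition Omega (l u : binseq) : set binseq :=
  [set x | forall n, lex_le (tail n x) l \/ lex_le u (tail n x)].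

Definition repeat (c : bool) : binseq := fun=> c.

Definition star (c : bool) (X : set binseq) : set binseq :=
  [set y | exists k x, X x /\ y = iter k (scons c) x].

Definition block (n : nat) (x : binseq) (i : nat) : n.-tuple bool :=
  [tuple x (i + j)%N | j < n].

Definition blocks (n : nat) (X : set binseq) : {set n.-tuple bool} :=
  [set w | `[< exists x i, X x /\ w = block n x i >]]%SET.

Definition num_blocks (n : nat) (X : set binseq) : nat := #|blocks n X|.

(* Natural logarithm.  Since [ln 0 = 0], the entropy of the empty set is 0
   (see [entropy0]).  The limit exists for every [X] (see [is_cvg_entropy]). *)
Definition entropy (R : realType) (X : set binseq) : R :=
  limn (fun n => ln (num_blocks n X)%:R / n%:R : R).

Lemma num_blocks0 n : num_blocks n set0 = 0%N.
Proof.
rewrite /num_blocks; apply/eqP; rewrite cards_eq0; apply/eqP/setP => w.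
by rewrite !inE; apply/asboolP => -[x [i [[]]]].
Qed.

Lemma entropy0 (R : realType) : entropy R set0 = 0.
Proof.
rewrite /entropy (_ : (fun n => _) = cst 0) ?lim_cst//.
by apply/funext => n; rewrite num_blocks0 ln0// mul0r.
Qed.

Lemma num_blocks_gt0 n X : X !=set0 -> (0 < num_blocks n X)%N.
Proof.
case=> x Xx; apply/card_gt0P; exists (block n x 0).
by rewrite inE; apply/asboolP; exists x, 0%N.
Qed.

Lemma num_blocksD m n X :
  (num_blocks (m + n) X <= num_blocks m X * num_blocks n X)%N.
Proof.
rewrite /num_blocks -cardsX.
pose f (w : (m + n).-tuple bool) : m.-tuple bool * n.-tuple bool :=
  ([tuple tnth w (lshift n j) | j < m], [tuple tnth w (rshift m j) | j < n]).
have f_inj : injective f.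
  move=> v w fvw; apply: eq_from_tnth => i; case: (split_ordP i) => j ->.
    by have := congr1 (fun p => tnth p.1 j) fvw; rewrite !tnth_mktuple.
  by have := congr1 (fun p => tnth p.2 j) fvw; rewrite !tnth_mktuple.
rewrite -(card_imset _ f_inj); apply/subset_leq_card/fintype.subsetP => p.
move=> /imsetP[w]; rewrite inE => /asboolP[x [i [Xx ->]]] ->.
rewrite !inE; apply/andP; split; apply/asboolP => /=.
  exists x, i; split=> //; apply: eq_from_tnth => j.
  by rewrite !tnth_mktuple.
exists x, (i + m)%N; split=> //; apply: eq_from_tnth => j.
by rewrite !tnth_mktuple /= addnA.
Qed.

Lemma fekete (R : realType) (u : nat -> R) :
  (forall n, 0 <= u n) -> (forall m n, u (m + n)%N <= u m + u n) ->
  cvgn (fun n => u n / n%:R).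
Proof.
move=> u_ge0 uD.
pose E := [set u n / n%:R | n in [set n | (0 < n)%N]].
have E_lb : lbound E 0 by move=> _ [n _ <-]; rewrite divr_ge0.
have hE : has_inf E by split; [exists (u 1%N / 1); exists 1%N | exists 0].
apply/cvg_ex; exists (inf E); apply/cvgrPdist_le => e e_gt0.
have e2_gt0 : 0 < e / 2 by rewrite divr_gt0.
have [_ [m /= m_gt0 <-] um] := inf_adherent e2_gt0 hE.
pose C := \sum_(r < m) u r.
have C_ge0 : 0 <= C by apply: sumr_ge0.
have u_mul q r : u (q * m + r)%N <= q%:R * u m + u r.
  elim: q => [|q IHq]; first by rewrite mul0n add0n mul0r add0r.
  rewrite mulSn -addnA; apply: (le_trans (uD _ _)).
  by rewrite -natr1 mulrDl mul1r; lra.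
have u_le n : u n <= n%:R * (u m / m%:R) + C.
  rewrite {1}(divn_eq n m); apply: (le_trans (u_mul _ _)); apply: lerD.
    rewrite mulrCA mulrC ler_wpM2l// ler_pdivlMr ?ltr0n//.
    by rewrite -natrM ler_nat leq_divM.
  have r_lt := ltn_pmod n m_gt0.
  by rewrite /C (bigD1 (Ordinal r_lt))//= lerDl sumr_ge0.
near=> n.
have n_gt0 : (0 < n)%N by near: n; exists 1%N.
have nR_gt0 : 0 < n%:R :> R by rewrite ltr0n.
have Cn : C / n%:R <= e / 2.
  rewrite ler_pdivrMr// mulrC -ler_pdivrMr//.
  by near: n; exact: nbhs_infty_ger.
have inf_le : inf E <= u n / n%:R by apply: ge_inf; [exists 0 | exists n].
have un_le : u n / n%:R <= u m / m%:R + C / n%:R.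
  by rewrite ler_pdivrMr// mulrDl divfK ?gt_eqF// [_ * n%:R]mulrC u_le.
rewrite ler_norml; apply/andP; split; lra.
Unshelve. all: by end_near. Qed.

Lemma is_cvg_entropy (R : realType) (X : set binseq) :
  cvgn (fun n => ln (num_blocks n X)%:R / n%:R : R).
Proof.
have [->|/set0P X_neq0] := eqVneq X set0.
  rewrite (_ : (fun n => _) = cst 0); first exact: is_cvg_cst.
  by apply/funext => n; rewrite num_blocks0 ln0// mul0r.
have A_gt0 n := num_blocks_gt0 n X_neq0.
apply: fekete => [n|m n]; first by rewrite ln_ge0// ler1n.
rewrite -lnM ?posrE ?ltr0n// -natrM ler_ln ?posrE ?ltr0n ?muln_gt0 ?A_gt0//.
by rewrite ler_nat num_blocksD.
Qed.

(* Main.v *)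
(** An element of Omega is a sequence whose tail is at most [b] after each digit
0 and at least [a] after each digit 1.  At the first place where a nonconstant
element changes digit, both bounds hold for the tail: one by the condition just
stated, the other because [0y <= y <= 1y].  The same inequalities propagate both
bounds to all later tails, so this tail is in Sigma.

For the entropy, a block of length [n] of [c^k x] is [c^j w] with [j <= n] and
[w] a prefix of a block of [x] of length [n], so that the numbers of blocks
differ by a factor linear in [n]. *)
Require Import Defs.
From mathcomp Require Import all_boot all_order all_algebra.
From mathcomp Require Import all_classical all_reals all_analysis.
From mathcomp Require Import zify lra.

Import Order.TTheory GRing.Theory Num.Theory.
Import numFieldNormedType.Exports.

Local Open Scope classical_set_scope.

(** * Lexicographic order on binary sequences *)

Lemma tailE n x : tail n x = scons (x n) (tail n.+1 x).
Proof. by apply/funext => -[|k] /=; rewrite /tail ?addn0// addnS addSn. Qed.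

Lemma tail0 x : tail 0 x = x.
Proof. exact/funext. Qed.

Lemma iter_sconsE c k x i :
  iter k (scons c) x i = if (i < k)%N then c else x (i - k)%N.
Proof. by elim: k i => [|k IHk] [|i] //=; rewrite IHk. Qed.

Lemma lex_lt_trans x y z : lex_lt x y -> lex_lt y z -> lex_lt x z.
Proof.
move=> [m [xy [xm ym]]] [n [yz [yn zn]]].
have [mn|nm|E] := ltngtP m n; last by rewrite -E ym in yn.
- exists m; split=> [k km|]; last by rewrite -yz.
  by rewrite xy// yz// (ltn_trans km).
- exists n; split=> [k kn|]; last by rewrite xy.
  by rewrite xy ?yz// (ltn_trans kn).
Qed.

Lemma lex_le_trans x y z : lex_le x y -> lex_le y z -> lex_le x z.
Proof.
move=> [->//|xy] [<-|yz]; first by right.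
by right; apply: lex_lt_trans xy yz.
Qed.

Lemma lex_le_scons c x y : lex_le (scons c x) (scons c y) <-> lex_le x y.
Proof.
split=> [[E|[[|n] [xy [xn yn]]]]|[->|[n [xy [xn yn]]]]]; try by left.
- by left; apply/funext => k; have := congr1 (@^~ k.+1) E.
- by rewrite /= in xn yn; rewrite xn in yn.
- by right; exists n; split=> // k kn; apply: (xy k.+1).
- by right; exists n.+1; split=> // -[|k] //; apply: xy.
Qed.

Lemma lex_le10 x y : ~ lex_le (scons true x) (scons false y).
Proof.
move=> [E|[[|n] [xy []//]]]; first by have := congr1 (@^~ 0%N) E.
by have := xy 0%N isT.
Qed.

Lemma eq_repeat_or c x :
  x = repeat c \/ exists2 n, x n = ~~ c & forall k, (k < n)%N -> x k = c.
Proof.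
have eqbN (u : bool) : (u == ~~ c) = (u != c) by case: u c => -[].
have [ex|no] := pselect (exists n, x n != c).
  right; case: (ex_minnP ex) => m; rewrite -eqbN => /eqP xm lt.
  by exists m => // k km; apply/eqP; apply: contraTT km => /lt; rewrite -leqNgt.
by left; apply/funext => n; apply/eqP; apply: contra_notT no => xn; exists n.
Qed.

Lemma scons_repeat c : scons c (repeat c) = repeat c.
Proof. by apply/funext => -[|k]. Qed.

(** Up to the first 1 of [x] both sequences show only 0; at that index the shifted sequence still
    shows 0. *)
Lemma scons_false_le x : lex_le (scons false x) x.
Proof.
have [->|[n xn lt]] := eq_repeat_or false x.
  by rewrite scons_repeat; left.
right; exists n; split=> [k kn|]; last by case: n xn lt => //= n xn ->.
by rewrite lt//; case: k kn => //= k /ltnW/lt.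
Qed.

Lemma le_scons_true x : lex_le x (scons true x).
Proof.
have [->|[n xn lt]] := eq_repeat_or true x.
  by rewrite scons_repeat; left.
right; exists n; split=> [k kn|]; last by case: n xn lt => //= n -> ->.
by rewrite lt//; case: k kn => //= k /ltnW/lt.
Qed.

Lemma repeat_false_le x : lex_le (repeat false) x.
Proof.
have [->|[n xn lt]] := eq_repeat_or false x; first by left.
by right; exists n; split=> // k /lt->.
Qed.

Lemma le_repeat_true x : lex_le x (repeat true).
Proof.
have [->|[n xn lt]] := eq_repeat_or true x; first by left.
by right; exists n; split=> // k /lt->.
Qed.

Lemma star0 c : star c set0 = set0.
Proof. by apply/seteqP; split=> // y [k [x []]]. Qed.

(** * Decomposition of [Omega] *)

Section OmegaDecomposition.
Variables a b : binseq.

Let S := Sigma a b.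
Let W := Omega (scons false b) (scons true a).

(** The first digit of a tail rules out one of the two alternatives; in the other, the common first
    digit cancels. *)
Lemma OmegaE x : W x <->
  forall n, if x n then lex_le a (tail n.+1 x) else lex_le (tail n.+1 x) b.
Proof.
split=> Wx n; move: (Wx n); rewrite (tailE n); case: (x n).
- by move=> [/lex_le10//|/lex_le_scons].
- by move=> [/lex_le_scons//|/lex_le10].
- by move=> ?; right; apply/lex_le_scons.
- by move=> ?; left; apply/lex_le_scons.
Qed.

Lemma Omega_scons c x : W x -> (if c then lex_le a x else lex_le x b) ->
  W (scons c x).
Proof.
move=> /OmegaE Wx cx; apply/OmegaE => -[|n]; last exact: Wx.
by rewrite (_ : tail 1 _ = x)//; apply/funext.
Qed.

Lemma Sigma_sub_Omega : S `<=` W.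
Proof. by move=> x Sx; apply/OmegaE => n; have [] := Sx n.+1; case: (x n). Qed.

Lemma star_Sigma_sub_Omega c : star c S `<=` W.
Proof.
move=> _ [k [x [Sx ->]]].
(* The induction carries the one bound that [Omega_scons] asks for. Prepending [c] preserves it, as
   1 moves a sequence up and 0 moves it down; the opposite bound may be lost. *)
suff [] : W (iter k (scons c) x) /\
    if c then lex_le a (iter k (scons c) x) else lex_le (iter k (scons c) x) b.
  by [].
elim: k => [|k [Wy cy]] /=.
  split; first exact: Sigma_sub_Omega.
  by have [] := Sx 0%N; rewrite tail0; case: c.
split; first exact: Omega_scons.
case: c {Wy} cy => ?; first exact: lex_le_trans (le_scons_true _).
exact: lex_le_trans (scons_false_le _) _.
Qed.

Lemma repeat_Omega c : W (repeat c).
Proof.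
by apply/OmegaE => n; case: c; [exact: le_repeat_true | exact: repeat_false_le].
Qed.

Lemma tail_Omega_Sigma x k : W x -> x k.+1 = ~~ x k -> S (tail k.+1 x).
Proof.
move=> /OmegaE Wx xk n.
have -> : tail n (tail k.+1 x) = tail (k.+1 + n) x.
  by apply/funext => i; rewrite /tail addnA.
elim: n => [|n [IHa IHb]].
  (* [Wx k] gives one bound on the tail. [Wx k.+1] gives the other on the next tail, and prepending
     the digit [~~ x k] carries it back. *)
  rewrite addn0; have := Wx k; have := Wx k.+1; rewrite (tailE k.+1) xk.
  case: (x k) => /= ? ?; split=> //.
    exact: lex_le_trans (scons_false_le _) _.
  exact: lex_le_trans (le_scons_true _).
rewrite addnS; have := Wx (k.+1 + n)%N; move: IHa IHb.
rewrite (tailE (k.+1 + n)); case: (x _) => IHa IHb ?; split=> //.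
  exact: lex_le_trans (le_scons_true _) IHb.
exact: lex_le_trans IHa (scons_false_le _).
Qed.

Lemma Omega_decomp :
  W = star false S `|` star true S `|` [set repeat false; repeat true].
Proof.
apply/seteqP; split=> [x Wx|x [[]|[]->]];
  try exact: star_Sigma_sub_Omega; try exact: repeat_Omega.
have [xr|[[|n] xn lt]] := eq_repeat_or (x 0%N) x.
- by right; rewrite xr; case: (x 0%N); [right | left].
- by case: (x 0%N) xn.
- left; have : star (x 0%N) S x.
    exists n.+1, (tail n.+1 x); split.
      by apply: tail_Omega_Sigma => //; rewrite xn (lt n).
    apply/funext => i; rewrite iter_sconsE; case: ltnP => [/lt//|ni].
    by rewrite /tail subnKC.
  by case: (x 0%N); [right | left].
Qed.

(** A point [x] of [S] would put both [0x] and [1x] in [W]; if both are constant, [x] starts with 0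
    and with 1. *)
Lemma Sigma_eq0 : S = set0 <-> W = [set repeat false; repeat true].
Proof.
split=> [S0|W2]; first by rewrite Omega_decomp S0 !star0 !set0U.
apply/seteqP; split=> // x Sx.
have WS c : [set repeat false; repeat true] (scons c x).
  by rewrite -W2; apply: (@star_Sigma_sub_Omega c); exists 1%N, x.
have D c : scons c x <> repeat (~~ c).
  by move=> /(congr1 (@^~ 0%N)); case: c.
have Er c : scons c x = repeat c.
  by case: c (WS c) (D c) => -[].
have := congr1 (@^~ 1%N) (Er true); have := congr1 (@^~ 1%N) (Er false).
by rewrite /= => ->.
Qed.

End OmegaDecomposition.

(** * Countability *)

Lemma countable_star c X : countable X -> countable (star c X).
Proof.
move=> cX.
have -> : star c X = \bigcup_(k in [set: nat]) (iter k (scons c) @` X).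
  by apply/seteqP; split=> y [k]; [move=> [x [Xx ->]]; exists k => //; exists x
    | move=> _ [x Xx <-]; exists k, x].
apply: bigcup_countable => // k _.
exact: sub_countable (card_image_le _ _) cX.
Qed.

Lemma countableU T (A B : set T) : countable A -> countable B ->
  countable (A `|` B).
Proof.
move=> cA cB; rewrite -bigcup2E; apply: bigcup_countable => // -[|[|k]] _.
- exact: cA.
- exact: cB.
- exact: countable0.
Qed.

Lemma Sigma_countable a b :
  countable (Sigma a b) <-> countable (Omega (scons false b) (scons true a)).
Proof.
split=> [cS|]; last exact/sub_countable/subset_card_le/Sigma_sub_Omega.
rewrite Omega_decomp; apply: countableU.
  by apply: countableU; exact: countable_star.
by apply: countableU; exact: countable1.
Qed.

(** * Counting blocks *)

Lemma nth_block n x i j : (j < n)%N -> nth false (block n x i) j = x (i + j)%N.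
Proof. by move=> jn; rewrite -(tnth_nth _ _ (Ordinal jn)) tnth_mktuple. Qed.

Lemma num_blocks_sub n X Y : X `<=` Y -> (num_blocks n X <= num_blocks n Y)%N.
Proof.
move=> XY; apply/subset_leq_card/fintype.subsetP => w.
rewrite inE => /asboolP[x [i [/XY Yx ->]]].
by rewrite inE; apply/asboolP; exists x, i.
Qed.

Lemma num_blocks_star n X :
  (num_blocks n (star false X `|` star true X `|`
     [set repeat false; repeat true]) <= 4 * n.+1 * maxn 1 (num_blocks n X))%N.
Proof.
(* A letter [c], a length [m] and a word [w] encode [c^m w], cut to length [n]. *)
pose fill (p : bool * 'I_n.+1 * n.-tuple bool) : n.-tuple bool :=
  [tuple if (j < p.1.2)%N then p.1.1 else nth false p.2 (j - p.1.2) | j < n].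
(* The constant block makes [D] nonempty even if [X] is empty, as the constant
   sequences require. *)
pose D := finset.setX [set: bool * 'I_n.+1]%SET
               (block n (repeat false) 0 |: blocks n X)%SET.
(* Two letters and [n.+1] lengths give [2 * n.+1]; the extra word costs another 2, since
   [1 + N <= 2 * maxn 1 N]. *)
have cardD : (#|D| <= 4 * n.+1 * maxn 1 (num_blocks n X))%N.
  rewrite cardsX cardsT card_prod card_bool card_ord cardsU1 -/(num_blocks n X).
  by case: (_ \notin _); nia.
apply: leq_trans cardD; apply: leq_trans (leq_imset_card fill D).
apply/subset_leq_card/fintype.subsetP => w.
have fill_repeat c i : block n (repeat c) i \in fill @: D.
  (* A run of length [n] fills the block, so the word is a mere placeholder. *)
  apply/imsetP; exists (c, ord_max, block n (repeat false) 0).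
    by rewrite !inE eqxx.
  by apply: eq_from_tnth => j; rewrite !tnth_mktuple /= ltn_ord.
have fill_star c y i : star c X y -> block n y i \in fill @: D.
  move=> [k [x [Xx ->]]].
  (* From position [i], [k - i] copies of [c] remain, capped at [n]; then [x] is read from position
     [i - k]. Truncated subtraction covers both [i < k] and [k <= i]. *)
  have lt : (minn n (k - i) < n.+1)%N by rewrite ltnS geq_minl.
  apply/imsetP; exists (c, Ordinal lt, block n x (i - k)).
    by rewrite !inE /=; apply/orP; right; apply/asboolP; exists x, (i - k)%N.
  apply: eq_from_tnth => j; rewrite !tnth_mktuple /= iter_sconsE.
  have jn := ltn_ord j.
  case: ltnP => ijk; case: ltnP => jk //; [lia|lia|].
  have jkn : (j - minn n (k - i) < n)%N by lia.
  rewrite -[RHS]/(nth false (block n x (i - k)) (j - minn n (k - i))).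
  by rewrite nth_block//; congr x; lia.
by rewrite inE => /asboolP[x [i [[[sx|sx]|[->|->]] ->]]] //;
  exact: fill_star sx.
Qed.

Local Open Scope ring_scope.

(** * Equality of entropies *)

Lemma near_ln_le_linear (R : realType) (e : R) : 0 < e ->
  \forall n \near \oo, ln (4 * n.+1)%:R <= e * n%:R.
Proof.
(* [ln u < u] at [u = t x] gives [ln x < t x - ln t]; here [t = e / 8]. *)
move=> e_gt0; have t_gt0 : 0 < e / 8 by rewrite divr_gt0.
near=> n.
have : ln (e / 8 * (4 * n.+1)%:R) < e / 8 * (4 * n.+1)%:R.
  by apply: ln_sublinear; rewrite mulr_gt0.
rewrite lnM ?posrE ?ltr0n// natrM -[n.+1%:R]natr1.
have : (e / 2 - ln (e / 8)) / (e / 2) <= n%:R.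
  by near: n; exact: nbhs_infty_ger.
rewrite ler_pdivrMr ?divr_gt0//.
by move: (ln (e / 8)) (ln _) => l m hn hm; lra.
Unshelve. all: by end_near. Qed.

(** The logarithm makes the linear factor an additive term, which is negligible after division by
    [n]. *)
Lemma entropy_eq (R : realType) X Y :
  (forall n, (num_blocks n X <= num_blocks n Y)%N) ->
  (forall n, (num_blocks n Y <= 4 * n.+1 * maxn 1 (num_blocks n X))%N) ->
  entropy R X = entropy R Y.
Proof.
move=> XY YX.
have ln_nat (m n : nat) : (m <= n)%N -> ln m%:R <= ln n%:R :> R.
  case: m => [_|m mn]; last first.
    by rewrite ler_ln ?posrE ?ltr0n ?ler_nat// (leq_trans _ mn).
  by rewrite [ln 0%:R]ln0//; case: n => [|n]; [rewrite ln0 |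
    rewrite ln_ge0// ler1n].
apply/eqP; rewrite eq_le; apply/andP; split.
  apply: ler_lim; [exact: is_cvg_entropy | exact: is_cvg_entropy |].
  by apply: nearW => n; rewrite ler_wpM2r// ln_nat.
apply/ler_addgt0Pr => e e_gt0.
(* Writing [e] as the limit of a constant sequence reduces the inequality to an eventual termwise
   one. *)
have lim_e : limn (cst e : nat -> R) = e by rewrite lim_cst.
rewrite /entropy -[e in leRHS]lim_e -limD;
  [|exact: is_cvg_entropy|exact: is_cvg_cst].
apply: ler_lim; [exact: is_cvg_entropy | |].
  by apply: is_cvgD; [exact: is_cvg_entropy | exact: is_cvg_cst].
near=> n.
have n_gt0 : (0 < n%:R :> R) by rewrite ltr0n; near: n; exists 1%N.
(* The default [ln 0 = 0] agrees with [ln 1], so the maximum with 1 disappears even when there are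
   no blocks. *)
have lnX : ln (maxn 1 (num_blocks n X))%:R = ln (num_blocks n X)%:R :> R.
  by case: (num_blocks n X) => [|m]; [rewrite ln1 ln0 | rewrite (maxn_idPr _)].
have /ln_nat := YX n.
rewrite natrM lnM ?posrE ?ltr0n ?leq_max// lnX => lnY.
rewrite /= ler_pdivrMr// mulrDl divfK ?gt_eqF// addrC.
apply: le_trans lnY _; rewrite lerD2r.
by near: n; exact: near_ln_le_linear.
Unshelve. all: by end_near. Qed.

Theorem theorem5 (R : realType) (a b : binseq) :
  Omega (scons false b) (scons true a) =
    star false (Sigma a b) `|` star true (Sigma a b) `|`
    [set repeat false; repeat true] /\
  (Sigma a b = set0 <->
     Omega (scons false b) (scons true a) = [set repeat false; repeat true]) /\
  (countable (Sigma a b) <->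
     countable (Omega (scons false b) (scons true a))) /\
  entropy R (Sigma a b) = entropy R (Omega (scons false b) (scons true a)).
Proof.
split; first exact: Omega_decomp.
split; first exact: Sigma_eq0.
split; first exact: Sigma_countable.
apply: entropy_eq => n; first exact/num_blocks_sub/Sigma_sub_Omega.
by rewrite Omega_decomp; exact: num_blocks_star.
Qed.
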